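(* For every $n\ge1$, there is a bijection between the set of subexcedent faro words of length $n$ and the set of Dumont permutations of the second kind of length $2n$ that avoid the classical pattern $2\text{-}1\text{-}4\text{-}3$.
   Context: Faro words are here taken over the $n$-ary alphabet $\{0,1,\dots,n-1\}$: a faro word of length $n$ is a word $w=w_1\cdots w_n$ obtained by interlacing two nondecreasing words $u,v$ as $u_1v_1u_2v_2\cdots$ with $0\le|u|-|v|\le1$ (equivalently, $w_i\le w_{i+2}$ for all $1\le i\le n-2$). It is subexcedent if $w_i\le i-1$ for all $1\le i\le n$. A Dumont permutation of the second kind of length $2n$ is a permutation $\pi$ of $\{1,\dots,2n\}$ with $\pi(2i-1)\ge2i-1$ and $\pi(2i)\le2i-1$ for all $1\le i\le n$. A permutation $\pi$ avoids $2\text{-}1\text{-}4\text{-}3$ if there are no indices $i_1<i_2<i_3<i_4$ with $\pi(i_2)<\pi(i_1)<\pi(i_4)<\pi(i_3)$. *)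

(* Defs.v *)
From mathcomp Require Import all_boot all_fingroup.
From mathcomp Require Import boolp classical_sets functions.

Set Implicit Arguments.
Unset Strict Implicit.
Unset Printing Implicit Defensive.

(* u_1 v_1 u_2 v_2 ...; once one of the words is exhausted, what remains of
   the other one is copied (at most one letter in the use below). *)
Fixpoint interlace (T : Type) (u v : seq T) : seq T :=
  match u, v with
  | x :: u', y :: v' => x :: y :: interlace u' v'
  | [::], _ => v
  | _, [::] => u
  end.

Definition nondecreasing_word (k : nat) (u : seq 'I_k) : bool :=
  sorted (fun a b : 'I_k => a <= b) u.

Definition faro (m k : nat) (w : m.-tuple 'I_k) : Prop :=
  exists u v : seq 'I_k,
    [/\ nondecreasing_word u, nondecreasing_word v,
        size v <= size u <= (size v).+1 & tval w = interlace u v].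

(* Positions are counted from 0 here, so that w_i <= i - 1 becomes w_i <= i. *)
Definition subexcedent (m k : nat) (w : m.-tuple 'I_k) : Prop :=
  forall i : 'I_m, tnth w i <= i.

(* A permutation of {1,...,2n} is encoded as a permutation of
   'I_(2 * n) = {0,...,2n-1}: positions and values are both shifted by one,
   so that pi(j + 1) = (p j).+1. *)
Definition dumont2 (n : nat) (p : 'S_(2 * n)) : Prop :=
  forall (i : nat) (j : 'I_(2 * n)), 1 <= i <= n ->
    (j.+1 = 2 * i - 1 -> 2 * i - 1 <= (p j).+1) /\
    (j.+1 = 2 * i -> (p j).+1 <= 2 * i - 1).

Definition avoids_2143 (m : nat) (p : 'S_m) : Prop :=
  ~ exists i1 i2 i3 i4 : 'I_m,
      [/\ i1 < i2, i2 < i3 & i3 < i4] /\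
      [/\ p i2 < p i1, p i1 < p i4 & p i4 < p i3].

Definition subexcedent_faro_words (n : nat) : set (n.-tuple 'I_n) :=
  [set w | faro w /\ subexcedent w]%classic.

Definition dumont2_avoiding_2143 (n : nat) : set 'S_(2 * n) :=
  [set p | dumont2 p /\ avoids_2143 p]%classic.

Arguments subexcedent_faro_words n _ : clear implicits.
Arguments dumont2_avoiding_2143 n _ : clear implicits.

(* Main.v *)
Require Import Defs.
From mathcomp Require Import all_boot all_fingroup.
From mathcomp Require Import boolp classical_sets functions.
From mathcomp Require Import zify.

Set Implicit Arguments.
Unset Strict Implicit.
Unset Printing Implicit Defensive.

(** Both sides turn out to be parametrized by a pair of 213-avoiding
permutations s, t of {0,...,n-1} with s(i) <= 2i and t(i) <= 2i+1 ([admissible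
0 s], [admissible 1 t]).

Permutations. Let p be a Dumont permutation of the second kind avoiding 2143,
with positions and values counted from 0, so that p(2j+1) <= 2j <= p(2j). If an
odd position carried a value >= n, some even position 2i would carry a value <
n, and the positions 2i, 2i+1, 2j, 2j+1 would form a 2143: each of the two
pairs is a descent and the first lies below the second ([dumont2_odd_low]).
Hence the small values sit at the odd positions and the large ones at the even
positions, and p is a [merge] of two permutations of size n: s read off the odd
positions, and t read off the odd positions of the reverse-complement of p. In
p, the last letter of a 213 of s is immediately preceded by a large value,
which makes it a 2143; since 2143 is invariant under reverse-complement, t
avoids 213 as well. Conversely a 2143 in a merge either contains a 213 of s or
of t, or consists of a descent of small values followed by a descent of large
ones; a count excludes the latter ([merge_avoids_2143]), so that s and t can be
chosen independently.

Words. The inversion code of s, k(j) = #{i < j : s(i) > s(j)}, is a bijection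
from permutations onto the functions with k(j) <= j. It is nondecreasing
exactly when s avoids 213 ([avoids_213P]), and for such s the condition s(i) <=
2i + c for all i becomes k(j) <= 2j + c - n for all j, with truncated
subtraction ([bounded_avoids_213P]). So the code of s vanishes for 2j <= n and
that of t for 2j + 1 <= n. The letter of index x (from 0) of the word attached
to (s, t) is the entry j = floor((n + x)/2) of the code of s if n + x is even,
of t if n + x is odd: with c = 0 or 1 accordingly, 2j + c = n + x, the bound
reads w_x <= x, which is subexcedence, and the two monotone codes give the two
interlaced nondecreasing subwords. *)

(** * Interlacing *)

Lemma size_interlace (T : Type) (u v : seq T) :
  size (interlace u v) = size u + size v.
Proof. by elim: u v => [|x u IH] [|y v] //=; rewrite ?addn0 // IH addnS. Qed.

Lemma nth_interlace (T : Type) (d : T) (u v : seq T) (i : nat) :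
  size v <= size u <= (size v).+1 ->
  nth d (interlace u v) i = nth d (if odd i then v else u) i./2.
Proof.
elim: u v i => [|x u IH] [|y v] i //=.
- by rewrite if_same !nth_nil.
- by case: u {IH} => //= _; case: i => [|[|i]] //=; case: (odd i); rewrite /= ?nth_nil.
- case: i => [|[|i]] //= h; rewrite IH ?negbK //.
  by case: (odd i).
Qed.

(** The two interlaced words are the letters of even and of odd index, so being
    faro is a local condition at distance two. *)
Lemma faroP (m k : nat) (d : 'I_k) (w : m.-tuple 'I_k) :
  faro w <-> forall i, i.+2 < m -> nth d w i <= nth d w i.+2.
Proof.
split=> [[u [v [su sv h ew]]] i hi|hw].
  have hsz : size u + size v = m by rewrite -size_interlace -ew size_tuple.
  have step s : nondecreasing_word s -> forall j, j.+1 < size s ->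
      nth d s j <= nth d s j.+1 by move=> /(sortedP d).
  rewrite ew !nth_interlace //= negbK.
  by case: ifP => oi; apply: step => //; lia.
pose u := mkseq (fun i => nth d w i.*2) (uphalf m).
pose v := mkseq (fun i => nth d w i.*2.+1) m./2.
have hsz : size v <= size u <= (size v).+1 by rewrite !size_mkseq; lia.
exists u, v; split=> //.
- apply/(sortedP d) => i; rewrite size_mkseq => hi.
  by rewrite !nth_mkseq ?doubleS; [apply: hw| |]; lia.
- apply/(sortedP d) => i; rewrite size_mkseq => hi.
  by rewrite !nth_mkseq ?doubleS; [apply: hw| |]; lia.
- apply: (@eq_from_nth _ d) => [|i].
    by rewrite size_interlace !size_mkseq size_tuple; lia.
  rewrite size_tuple => hi; rewrite nth_interlace //.
  by case: ifP => oi; rewrite nth_mkseq; try lia; congr nth; lia.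
Qed.

Lemma faro_leq_nth (m k : nat) (d : 'I_k) (w : m.-tuple 'I_k) (x y : nat) :
  faro w -> x <= y < m -> odd x = odd y -> nth d w x <= nth d w y.
Proof.
move=> /(faroP d) hw hxy oxy; have -> : y = x + (y - x)./2.*2 by lia.
have : x + (y - x)./2.*2 < m by lia.
elim: (y - x)./2 => [|t IH] ht; first by rewrite addn0.
rewrite doubleS !addnS in ht *; apply: leq_trans (hw _ ht); apply: IH; lia.
Qed.

(** * Inversion codes and the pattern 213 *)

Definition avoids_213 (n : nat) (s : 'S_n) : Prop :=
  forall i j k : 'I_n, i < j -> j < k -> s j < s i -> s i < s k -> False.

Definition inv_code (n : nat) (s : 'S_n) (j : 'I_n) : nat :=
  #|[set i : 'I_n | (i < j) && (s j < s i)]|.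

Lemma card_ord_lt (n b : nat) : b <= n -> #|[set i : 'I_n | i < b]| = b.
Proof.
move=> hb; rewrite -sum1dep_card -[RHS]card_ord -sum1_card.
by rewrite (big_ord_widen n (fun=> 1)).
Qed.

Lemma card_ord_itv (n a b : nat) :
  a <= b <= n -> #|[set i : 'I_n | a <= i < b]| = b - a.
Proof.
move=> /andP[ab bn].
have -> : b - a = #|[set i : 'I_n | i < b] :\: [set i : 'I_n | i < a]|.
  rewrite cardsDS ?card_ord_lt ?(leq_trans ab) //.
  by apply/fintype.subsetP => i; rewrite !inE => /leq_trans; apply.
by apply: eq_card => i; rewrite !inE -leqNgt.
Qed.

Lemma inv_code_leq (n : nat) (s : 'S_n) (j : 'I_n) : inv_code s j <= j.
Proof.
rewrite -[leqRHS](@card_ord_lt n); last exact: ltnW.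
by apply/subset_leq_card/fintype.subsetP => i; rewrite !inE => /andP[].
Qed.

(** A permutation is recovered from its code from the last position backwards:
    once the values at later positions are known, the code says which of the
    remaining values, counted from the top, stands at position j. *)
Lemma inv_code_inj (n : nat) (s t : 'S_n) :
  (forall j, inv_code s j = inv_code t j) -> s = t.
Proof.
have wlogP (s' t' : 'S_n) (j : 'I_n) :
    (forall i : 'I_n, j < i -> s' i = t' i) -> s' j < t' j ->
    inv_code t' j < inv_code s' j.
  move=> later lt_st.
  (* Counted by values instead of positions, both codes select from the same
     set of values, and the smaller threshold selects strictly more. *)
  have e (r : 'S_n) : inv_code r j = #|[set v : 'I_n | (r^-1%g v < j) && (r j < v)]|.
    rewrite -[LHS](card_imset _ (@perm_inj _ r)).
    apply: eq_card => v; apply/imsetP/idP => [[i]|].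
      by rewrite !inE => h ->; rewrite permK.
    by rewrite inE => h; exists (r^-1%g v); rewrite ?inE permKV.
  have leqV v : (s'^-1%g v <= j) = (t'^-1%g v <= j).
    apply/idP/idP; apply: contraTT; rewrite -!ltnNge => h.
      by have := later _ h; rewrite permKV => /(canRL (permK _)) <-.
    by have := later _ h; rewrite permKV => /esym /(canRL (permK _)) <-.
  rewrite !e; apply/proper_card/fintype.properP; split.
    apply/fintype.subsetP => v; rewrite !inE => /andP[h1 h2].
    have : s'^-1%g v <= j by rewrite leqV ltnW.
    rewrite leq_eqVlt => /orP[/eqP/val_inj|->]; last by rewrite (ltn_trans lt_st).
    by move=> /(canRL (permKV _)) ev; have := ltn_trans lt_st h2; rewrite ev ltnn.
  exists (t' j); rewrite !inE ?permK ?ltnn //= lt_st andbT ltn_neqAle leqV permK leqnn andbT.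
  by apply/eqP => /val_inj /(canRL (permKV _)) ej; rewrite ej ltnn in lt_st.
move=> eqc; apply/permP => j.
move: {2}(n - j) (leqnn (n - j)) => m; elim: m j => [|m IH] j hm.
  by have := ltn_ord j; lia.
have later (i : 'I_n) : j < i -> s i = t i by move=> h; apply: IH; lia.
case: (ltngtP (s j) (t j)) => [h|h|/val_inj //].
- by have := wlogP _ _ _ later h; rewrite eqc ltnn.
- have := wlogP t s j (fun i hi => esym (later i hi)) h; by rewrite eqc ltnn.
Qed.

(** Surjectivity by counting: there are n! functions below the identity, as many
    as permutations, and the code is injective. *)
Lemma inv_code_surj (n : nat) (c : 'I_n -> nat) :
  (forall j, c j <= j) -> exists s : 'S_n, forall j, inv_code s j = c j.
Proof.
move=> hc.
have lt_n (b : 'I_n -> nat) (hb : forall j, b j <= j) j : b j < n.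
  exact: leq_ltn_trans (hb j) (ltn_ord j).
pose F (j : 'I_n) := [pred k : 'I_n | k <= j].
pose code (s : 'S_n) : {ffun 'I_n -> 'I_n} :=
  [ffun j => Ordinal (lt_n _ (inv_code_leq s) j)].
have code_inj : injective code.
  by move=> s t /ffunP h; apply: inv_code_inj => j; have := h j; rewrite !ffunE => -[].
have sub : [set code s | s in [set: 'S_n]] \subset [set f | f \in family F].
  apply/fintype.subsetP => _ /imsetP[s _ ->]; rewrite inE; apply/familyP => j.
  by rewrite ffunE inE /= inv_code_leq.
have eqcard : #|[set f | f \in family F]| = n`!.
  rewrite cardsE card_family fact_prod.
  rewrite foldrE big_map big_enum /= (big_addn 0 n.+1 1) subn1 big_mkord.
  apply: eq_bigr => j _; rewrite addn1 -[RHS](@card_ord_lt n) //.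
  by apply: eq_card => k; rewrite !inE ltnS.
have img : [set code s | s in [set: 'S_n]] = [set f | f \in family F].
  apply/eqP; rewrite eqEcard sub eqcard card_imset // cardsT.
  by rewrite -card_Sn; apply/subset_leq_card/fintype.subsetP.
have : [ffun j => Ordinal (lt_n _ hc j)] \in [set f | f \in family F].
  by rewrite inE; apply/familyP => j; rewrite ffunE inE /=.
rewrite -img => /imsetP[s _ /ffunP h]; exists s => j.
by have := h j; rewrite !ffunE => -[].
Qed.

Lemma card_perm_lt (n b : nat) (s : 'S_n) :
  b <= n -> #|[set i : 'I_n | s i < b]| = b.
Proof.
move=> bn; rewrite -[RHS](card_ord_lt bn) -[RHS](card_preimset _ (@perm_inj _ s)).
by apply: eq_card => i; rewrite !inE.
Qed.

(** If s avoids 213, whatever is left of j and exceeds s(j) also exceeds s(k),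
    for every k > j. Conversely, given a 213 at i < j < k with k least, the
    entry just before k is still below s(i), and passing from it to k loses the
    inversion with i and gains none. *)
Lemma avoids_213P (n : nat) (s : 'S_n) :
  avoids_213 s <->
  forall j k : 'I_n, j <= k -> inv_code s j <= inv_code s k.
Proof.
split=> [av j k|mono i j k ij jk sji sik].
  rewrite leq_eqVlt => /orP[/eqP/val_inj -> //|jk].
  apply/subset_leq_card/fintype.subsetP => i; rewrite !inE => /andP[ij sji].
  rewrite (ltn_trans ij jk) /= ltnNge leq_eqVlt; apply/negP.
  move=> /orP[/eqP/val_inj/perm_inj eik|sik]; last exact: av ij jk sji sik.
  by move: jk; rewrite -eik ltnNge ltnW.
have [k' /andP[jk' sik'] kmin] :=
  @arg_minnP _ k (fun l : 'I_n => (j < l) && (s i < s l)) val (introT andP (conj jk sik)).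
have lt1 : k'.-1 < n by have := ltn_ord k'; lia.
pose k1 := Ordinal lt1.
have sk1 : s k1 < s i.
  case: (ltngtP (s k1) (s i)) => // [h|/val_inj/perm_inj e].
    case: (ltngtP j k1) => [jk1||].
    - have /= := kmin k1; rewrite jk1 h => /(_ isT); lia.
    - by rewrite /=; lia.
    - by move=> e; have ej : k1 = j by [apply: val_inj]; rewrite ej in h; lia.
  by have := congr1 val e; rewrite /=; lia.
have /= := mono k1 k' (leq_pred _); rewrite leqNgt => /negP; apply.
apply/proper_card/fintype.properP; split.
  apply/fintype.subsetP => l; rewrite !inE => /andP[lk' skl].
  rewrite (ltn_trans (ltn_trans sk1 sik') skl) andbT /=.
  case: (ltngtP l k'.-1) => // [|e]; first lia.
  have el : l = k1 by apply/val_inj.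
  by rewrite el in skl; lia.
by exists i; rewrite !inE; rewrite /=; lia.
Qed.

(** Take i0 least among the positions inverted with j. Everything before i0 is
    below s(j), and everything from j on is below s(i0) by 213-avoidance. Hence
    s(i0) >= n - (j - i0), and the bound at i0 makes i0 too large for the j - i0
    possible inversions of j to exceed 2j + c - n. *)
Lemma inv_code_leq_of_bounded (n c : nat) (s : 'S_n) (i j : 'I_n) :
  avoids_213 s -> (forall i : 'I_n, s i <= i.*2 + c) ->
  i < j -> s j < s i -> inv_code s j <= j.*2 + c - n.
Proof.
move=> av bound ij sji.
have [i0 /andP[i0j sji0] imin] :=
  @arg_minnP _ i (fun l : 'I_n => (l < j) && (s j < s l)) val (introT andP (conj ij sji)).
have before (l : 'I_n) : l < i0 -> s l < s j.
  move=> li0; case: (ltngtP (s l) (s j)) => // [h|/val_inj/perm_inj e].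
    by have /= := imin l; rewrite h (ltn_trans li0 i0j) => /(_ isT); lia.
  by rewrite e in li0; lia.
have after (l : 'I_n) : j <= l -> s l < s i0.
  rewrite leq_eqVlt => /orP[/eqP/val_inj <- //|jl].
  case: (ltngtP (s l) (s i0)) => // [h|/val_inj/perm_inj e].
    by case: (av i0 j l i0j jl sji0 h).
  by rewrite e in jl; lia.
have hj := ltn_ord j.
have small : n - (j - i0) <= s i0.
  have hC := cardsC [set l : 'I_n | i0 <= l < j].
  rewrite card_ord card_ord_itv in hC; last lia.
  suff : #|~: [set l : 'I_n | i0 <= l < j]| <= s i0 by lia.
  rewrite -[leqRHS](card_perm_lt s (ltnW (ltn_ord (s i0)))).
  apply/subset_leq_card/fintype.subsetP => l; rewrite !inE negb_and -!ltnNge.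
  by case/orP => [/before h|/after //]; apply: ltn_trans h sji0.
have code : inv_code s j <= j - i0.
  rewrite -(@card_ord_itv n i0 j); last lia.
  apply/subset_leq_card/fintype.subsetP => l; rewrite !inE => /andP[lj sl].
  rewrite lj andbT leqNgt; apply/negP => /before; lia.
have := bound i0; lia.
Qed.

(** For the converse, if s(i) > 2i + c then more than i + c smaller values come
    after i. Let j be the position of the first of them: every position of
    [i, j) is inverted with j, so the code at j is at least j - i. The bound at
    j then gives n - j <= i + c, too few positions for those values. *)
Lemma bounded_avoids_213P (n c : nat) (s : 'S_n) :
  avoids_213 s ->
  (forall i : 'I_n, s i <= i.*2 + c) <->
  (forall j : 'I_n, inv_code s j <= j.*2 + c - n).
Proof.
move=> av; split=> [bound j|bound i].
  case: (posnP (inv_code s j)) => [-> //|].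
  rewrite /inv_code card_gt0 => /set0Pn[i]; rewrite inE => /andP[ij sji].
  exact: inv_code_leq_of_bounded av bound ij sji.
rewrite leqNgt; apply/negP => big.
pose P (l : 'I_n) := (i < l) && (s l < s i).
have many : i.+1 + c <= #|[set l : 'I_n | P l]|.
  have hs : s i <= #|[set l : 'I_n | l < i] :|: [set l : 'I_n | P l]|.
    rewrite -(card_perm_lt s (ltnW (ltn_ord (s i)))).
    apply/subset_leq_card/fintype.subsetP => l; rewrite !inE /P => sl.
    rewrite sl andbT; case: ltngtP => // /val_inj e.
    by rewrite e ltnn in sl.
  have := leq_trans hs (leq_card_setU _ _).
  rewrite card_ord_lt ?(ltnW (ltn_ord i)) //; lia.
have /set0Pn[l0] : [set l : 'I_n | P l] != finset.set0 by rewrite -card_gt0; lia.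
rewrite inE => Pl0.
have [j /andP[ij sji] jmin] := @arg_minnP _ l0 P val Pl0.
have lej : #|[set l : 'I_n | P l]| <= n - j.
  rewrite -(@card_ord_itv n j n); last by rewrite leqnn ltnW.
  apply/subset_leq_card/fintype.subsetP => l; rewrite !inE => /jmin ->.
  by rewrite ltn_ord.
have code : j - i <= inv_code s j.
  rewrite -(@card_ord_itv n i j); last by rewrite ltnW //= ltnW.
  apply/subset_leq_card/fintype.subsetP => l; rewrite !inE => /andP[il lj].
  rewrite lj /=; move: il; rewrite leq_eqVlt => /orP[/eqP/val_inj <- //|il].
  apply: (ltn_trans sji); rewrite ltnNge leq_eqVlt; apply/negP.
  move=> /orP[/eqP/val_inj/perm_inj e|sli]; first by rewrite e in il; lia.
  by have := jmin l; rewrite /P il sli => /(_ isT); rewrite leqNgt lj.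
have := bound j; lia.
Qed.

(** * Reverse-complement and merging *)

Definition revcomp (m : nat) (p : 'S_m) : 'S_m :=
  (perm (@rev_ord_inj m) * p * perm (@rev_ord_inj m))%g.

Lemma revcompE (m : nat) (p : 'S_m) (x : 'I_m) :
  revcomp p x = rev_ord (p (rev_ord x)).
Proof. by rewrite !permM !permE. Qed.

Lemma revcompK (m : nat) : involutive (@revcomp m).
Proof. by move=> p; apply/permP => x; rewrite !revcompE !rev_ordK. Qed.

Lemma avoids_2143_revcomp (m : nat) (p : 'S_m) :
  avoids_2143 p -> avoids_2143 (revcomp p).
Proof.
move=> av [i1 [i2 [i3 [i4 [[h12 h23 h34] []]]]]]; rewrite !revcompE /= => h21 h14 h43.
apply: av; exists (rev_ord i4), (rev_ord i3), (rev_ord i2), (rev_ord i1).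
have l1 := ltn_ord i1; have l2 := ltn_ord i2.
have l3 := ltn_ord i3; have l4 := ltn_ord i4.
by split; split=> /=; lia.
Qed.

Definition low_ord (n : nat) (v : 'I_n) : 'I_(2 * n) :=
  widen_ord (@leq_pmull n 2 isT) v.

Lemma odd_ord_subproof (n : nat) (j : 'I_n) : j.*2.+1 < 2 * n.
Proof. by have := ltn_ord j; lia. Qed.

Definition odd_ord (n : nat) (j : 'I_n) : 'I_(2 * n) :=
  Ordinal (odd_ord_subproof j).

Lemma half_ord_subproof (n : nat) (x : 'I_(2 * n)) : x./2 < n.
Proof. by have := ltn_ord x; lia. Qed.

Definition half_ord (n : nat) (x : 'I_(2 * n)) : 'I_n :=
  Ordinal (half_ord_subproof x).

Lemma odd_ordK (n : nat) : cancel (@odd_ord n) (@half_ord n).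
Proof. by move=> j; apply: val_inj => /=; lia. Qed.

Lemma half_ordK (n : nat) (x : 'I_(2 * n)) : odd x -> odd_ord (half_ord x) = x.
Proof. by move=> ox; apply: val_inj => /=; lia. Qed.

Lemma odd_rev_ord (n : nat) (x : 'I_(2 * n)) : odd (rev_ord x) = ~~ odd x.
Proof. by have := ltn_ord x; rewrite /=; lia. Qed.

Lemma odd_neq_rev_odd (n : nat) (i j : 'I_n) : odd_ord i <> rev_ord (odd_ord j).
Proof. by move=> /(congr1 val) /=; have := ltn_ord i; have := ltn_ord j; lia. Qed.

(** The small values, at the odd positions, spell s; the large ones, at the
    even positions, spell the reverse-complement of t. Reversing t makes the
    two arguments play the same part, exchanged by [revcomp]. *)
Definition merge_fun (n : nat) (s t : 'S_n) (x : 'I_(2 * n)) : 'I_(2 * n) :=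
  if odd x then low_ord (s (half_ord x))
  else rev_ord (low_ord (t (half_ord (rev_ord x)))).

Lemma low_ord_inj (n : nat) : injective (@low_ord n).
Proof. by move=> i j /(congr1 val) /= /val_inj. Qed.

Lemma low_neq_high (n : nat) (i j : 'I_n) : low_ord i <> rev_ord (low_ord j).
Proof.
by move=> /(congr1 val) /=; have := ltn_ord i; have := ltn_ord j; lia.
Qed.

Lemma merge_fun_inj (n : nat) (s t : 'S_n) : injective (merge_fun s t).
Proof.
move=> x y; rewrite /merge_fun; case: ifP => ox; case: ifP => oy.
- move=> /low_ord_inj /perm_inj e.
  by rewrite -(half_ordK ox) e half_ordK.
- by move/low_neq_high.
- by move/esym/low_neq_high.
- move=> /rev_ord_inj /low_ord_inj /perm_inj e; apply: rev_ord_inj.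
  by rewrite -(@half_ordK _ (rev_ord x)) ?odd_rev_ord ?ox // e half_ordK ?odd_rev_ord ?oy.
Qed.

Definition merge (n : nat) (s t : 'S_n) : 'S_(2 * n) := perm (@merge_fun_inj n s t).

Lemma merge_odd_ord (n : nat) (s t : 'S_n) (j : 'I_n) :
  merge s t (odd_ord j) = low_ord (s j).
Proof. by rewrite permE /merge_fun /= odd_double /= odd_ordK. Qed.

Lemma revcomp_merge (n : nat) (s t : 'S_n) : revcomp (merge s t) = merge t s.
Proof.
apply/permP => x; rewrite revcompE !permE /merge_fun odd_rev_ord.
by case: (odd x); rewrite /= ?rev_ordK.
Qed.

Lemma merge_inj (n : nat) (s t s' t' : 'S_n) :
  merge s t = merge s' t' -> s = s' /\ t = t'.
Proof.
move=> e; split; apply/permP => j; apply: low_ord_inj.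
  by rewrite -(merge_odd_ord s t) e merge_odd_ord.
by rewrite -(merge_odd_ord t s) -revcomp_merge e revcomp_merge merge_odd_ord.
Qed.

Definition odd_low (n : nat) (p : 'S_(2 * n)) : Prop :=
  forall j : 'I_n, p (odd_ord j) < n.

Lemma perm_of_odd_low (n : nat) (p : 'S_(2 * n)) :
  odd_low p -> exists s : 'S_n, forall j, p (odd_ord j) = low_ord (s j).
Proof.
move=> low; have inj : injective (fun j => Ordinal (low j)).
  by move=> i j /(congr1 val) /= /val_inj /perm_inj /(can_inj (@odd_ordK n)).
by exists (perm inj) => j; apply: val_inj; rewrite /= permE.
Qed.

(** If the odd positions carry values < n, they carry all of them, by counting,
    so the even positions carry the values >= n. *)
Lemma odd_low_revcomp (n : nat) (p : 'S_(2 * n)) : odd_low p -> odd_low (revcomp p).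
Proof.
move=> /perm_of_odd_low[s es] j; rewrite ltnNge; apply/negP => high.
have lt_n : p (rev_ord (odd_ord j)) < n.
  by move: high; rewrite revcompE /=; have := ltn_ord (p (rev_ord (odd_ord j))); lia.
have := es (s^-1%g (Ordinal lt_n)); rewrite permKV.
by move=> /(congr1 val) /= /val_inj /perm_inj /odd_neq_rev_odd.
Qed.

Lemma split_odd_low (n : nat) (p : 'S_(2 * n)) :
  odd_low p -> exists s t : 'S_n, p = merge s t.
Proof.
move=> low; have [s es] := perm_of_odd_low low.
have [t et] := perm_of_odd_low (odd_low_revcomp low).
exists s, t; apply/permP => x; rewrite permE /merge_fun; case: ifP => ox.
  by rewrite -es half_ordK.
by rewrite -et half_ordK ?odd_rev_ord ?ox // revcompE !rev_ordK.
Qed.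

(** * Dumont permutations avoiding 2143 as merges *)

Definition odd_bounded (n c : nat) (p : 'S_(2 * n)) : Prop :=
  forall j : 'I_n, p (odd_ord j) <= j.*2 + c.

(** Excedance at the even positions is a bound on the odd positions of the
    reverse-complement, since p(2j) >= 2j becomes a value at most
    2(n-1-j) + 1 at the position 2(n-1-j) + 1. *)
Lemma dumont2P (n : nat) (p : 'S_(2 * n)) :
  dumont2 p <-> odd_bounded 0 p /\ odd_bounded 1 (revcomp p).
Proof.
split=> [d|[lo hi] i j hin].
  split=> j; have lj := ltn_ord j.
    have [_ /(_ _)] := d j.+1 (odd_ord j) lj; rewrite /=; lia.
  have [] := d (n - j) (rev_ord (odd_ord j)); first lia.
  by rewrite revcompE /= => h _; have := h _; lia.
have lj := ltn_ord j; split=> e.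
- have o : odd (rev_ord j) by rewrite odd_rev_ord; lia.
  have := hi (half_ord (rev_ord j)); rewrite half_ordK // revcompE rev_ordK /=; lia.
- have o : odd j by lia.
  have := lo (half_ord j); rewrite half_ordK //=; lia.
Qed.

(** A large value at the odd position 2j+1 forces by counting a small one at an
    even position 2k, and then 2k <= p(2k) < n <= p(2j+1) <= 2j. The positions
    2k < 2k+1 < 2j < 2j+1 form a 2143. *)
Lemma dumont2_odd_low (n : nat) (p : 'S_(2 * n)) :
  dumont2 p -> avoids_2143 p -> odd_low p.
Proof.
move=> /dumont2P[lo hi] av j; rewrite ltnNge; apply/negP => hj.
have [i pi] : exists i, p (rev_ord (odd_ord i)) < n.
  apply/existsP; apply: contraT; rewrite negb_exists => /forallP all_high.
  have /odd_low_revcomp : odd_low (revcomp p).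
    by move=> i; have := all_high i; rewrite revcompE /= -leqNgt; have := ltn_ord i; lia.
  by rewrite revcompK => /(_ j); rewrite ltnNge hj.
(* The even position 2k appears as the reverse of the odd position
   2(n-1-k) + 1. *)
have hi' (k : 'I_n) : k.*2 <= p (rev_ord (odd_ord (rev_ord k))).
  have := hi (rev_ord k); rewrite revcompE /=.
  have := ltn_ord (p (rev_ord (odd_ord (rev_ord k)))); have := ltn_ord k; lia.
have desc (k : 'I_n) : p (odd_ord k) < p (rev_ord (odd_ord (rev_ord k))).
  have := leq_trans (lo k) (_ : _ <= _); rewrite addn0 => /(_ _ (hi' k)).
  by rewrite leq_eqVlt => /orP[/eqP/val_inj/perm_inj/odd_neq_rev_odd|].
have [k pk] : exists k, p (rev_ord (odd_ord (rev_ord k))) < n.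
  by exists (rev_ord i); rewrite rev_ordK.
apply: av; exists (rev_ord (odd_ord (rev_ord k))), (odd_ord k),
  (rev_ord (odd_ord (rev_ord j))), (odd_ord j).
have := hi' k; have := lo j; have := ltn_ord k; have := ltn_ord j.
move=> ? ? ? ?; split; split; rewrite ?desc //=; lia.
Qed.

(** A 213 of s at i < j < k becomes a 2143 of the merge: the large value at
    position 2k serves as the 4, since 2j + 1 < 2k < 2k + 1. *)
Lemma merge_avoids_213 (n : nat) (s t : 'S_n) :
  avoids_2143 (merge s t) -> avoids_213 s.
Proof.
move=> av i j k ij jk sji sik.
apply: av; exists (odd_ord i), (odd_ord j), (rev_ord (odd_ord (rev_ord k))), (odd_ord k).
rewrite !merge_odd_ord permE /merge_fun odd_rev_ord /= odd_double /=.
set v := t _; have lk := ltn_ord k; have ls := ltn_ord (s k); have lv := ltn_ord v.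
by split; split => //=; lia.
Qed.

Lemma merge_odd_bounded (n c : nat) (s t : 'S_n) :
  odd_bounded c (merge s t) <-> forall j : 'I_n, s j <= j.*2 + c.
Proof. by split=> h j; have := h j; rewrite merge_odd_ord. Qed.

Lemma merge_low (n : nat) (s t : 'S_n) (x : 'I_(2 * n)) :
  (merge s t x < n) = odd x.
Proof.
rewrite permE /merge_fun; case: ifP => ox /=; first by rewrite ltn_ord.
by have := ltn_ord (t (half_ord (rev_ord x))); lia.
Qed.

Lemma merge_odd (n : nat) (s t : 'S_n) (x : 'I_(2 * n)) :
  odd x -> merge s t x = s (half_ord x) :> nat.
Proof. by move=> ox; rewrite permE /merge_fun ox. Qed.

Lemma merge_even (n : nat) (s t : 'S_n) (x : 'I_(2 * n)) :
  ~~ odd x -> merge s t x = 2 * n - (t (half_ord (rev_ord x))).+1 :> nat.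
Proof. by move=> ox; rewrite permE /merge_fun (negPf ox). Qed.

Lemma inv_code_gt0 (n : nat) (s : 'S_n) (i j : 'I_n) :
  i < j -> s j < s i -> 0 < inv_code s j.
Proof. by move=> ij sji; rewrite card_gt0; apply/set0Pn; exists i; rewrite inE ij. Qed.

Definition admissible (n c : nat) (s : 'S_n) : Prop :=
  avoids_213 s /\ forall i : 'I_n, s i <= i.*2 + c.

(** The case that is not a 213 of s or t is a descent of small values at odd
    positions, ending at 2b+1, followed by a descent of large values at even
    positions, starting at 2c. Then the code of s is positive at b and that of
    t at n-1-c, so that 2b > n and 2(n-1-c) >= n by the bounds on codes, whereas
    2b + 1 < 2c. *)
Lemma merge_avoids_2143 (n : nat) (s t : 'S_n) :
  admissible 0 s -> admissible 1 t -> avoids_2143 (merge s t).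
Proof.
move=> [avs bs] [avt bt] [i1 [i2 [i3 [i4 [[h12 h23 h34] [h21 h14 h43]]]]]].
have l1 := ltn_ord i1; have l2 := ltn_ord i2.
have l3 := ltn_ord i3; have l4 := ltn_ord i4.
have low := merge_low s t.
case o4: (odd i4).
  have o1 : odd i1 by rewrite -low (ltn_trans h14) // low.
  have o2 : odd i2 by rewrite -low (ltn_trans h21) // low.
  rewrite !merge_odd // in h21 h14.
  by apply: avs h21 h14 => /=; lia.
have o3 : ~~ odd i3 by rewrite -low -leqNgt ltnW // (leq_ltn_trans _ h43) // leqNgt low o4.
have tlt x : t x < n by exact: ltn_ord.
case o1: (odd i1); last first.
  rewrite !merge_even ?o1 ?o4 // in h14 h43.
  have t1 := tlt (half_ord (rev_ord i1)).
  have t3 := tlt (half_ord (rev_ord i3)); have t4 := tlt (half_ord (rev_ord i4)).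
  by apply: (avt (half_ord (rev_ord i4)) (half_ord (rev_ord i3))
    (half_ord (rev_ord i1))) => /=; lia.
have o2 : odd i2 by rewrite -low (ltn_trans h21) // low.
rewrite !merge_odd // in h21; rewrite !merge_even ?o4 // in h43.
have t3 := tlt (half_ord (rev_ord i3)); have t4 := tlt (half_ord (rev_ord i4)).
have := @inv_code_gt0 _ s _ _ _ h21.
have := @inv_code_gt0 _ t (half_ord (rev_ord i4)) (half_ord (rev_ord i3)).
have /(_ (half_ord i2)) := (bounded_avoids_213P 0 avs).1 bs.
have /(_ (half_ord (rev_ord i3))) := (bounded_avoids_213P 1 avt).1 bt.
rewrite /=; lia.
Qed.

Lemma merge_dumont2_avoiding (n : nat) (s t : 'S_n) :
  dumont2_avoiding_2143 n (merge s t) <-> admissible 0 s /\ admissible 1 t.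
Proof.
split=> [[/dumont2P]|[as_ at_]]; rewrite ?revcomp_merge.
  move=> [/merge_odd_bounded bs /merge_odd_bounded bt] av; split; split=> //.
    exact: merge_avoids_213 av.
  by apply: (@merge_avoids_213 _ _ s); rewrite -revcomp_merge; apply: avoids_2143_revcomp.
split; last exact: merge_avoids_2143.
apply/dumont2P; rewrite revcomp_merge; split; apply/merge_odd_bounded.
  by case: as_.
by case: at_.
Qed.

(** * Words from pairs of codes *)

Lemma mid_ord_subproof (n : nat) (x : 'I_n) : (n + x)./2 < n.
Proof. by have := ltn_ord x; lia. Qed.

Definition mid_ord (n : nat) (x : 'I_n) : 'I_n := Ordinal (mid_ord_subproof x).

Definition code_ord (n : nat) (s : 'S_n) (j : 'I_n) : 'I_n :=
  Ordinal (leq_ltn_trans (inv_code_leq s j) (ltn_ord j)).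

Definition word (n : nat) (s t : 'S_n) : n.-tuple 'I_n :=
  [tuple code_ord (if odd (n + x) then t else s) (mid_ord x) | x < n].

Lemma nth_word (n : nat) (s t : 'S_n) (d : 'I_n) (x : 'I_n) :
  nth d (word s t) x = inv_code (if odd (n + x) then t else s) (mid_ord x) :> nat.
Proof. by rewrite -tnth_nth tnth_mktuple. Qed.

Lemma admissibleP (n c : nat) (s : 'S_n) :
  admissible c s <->
  (forall j k : 'I_n, j <= k -> inv_code s j <= inv_code s k) /\
  (forall j : 'I_n, inv_code s j <= j.*2 + c - n).
Proof.
rewrite /admissible -avoids_213P; split=> -[av b]; split=> //.
  exact/bounded_avoids_213P.
exact/(bounded_avoids_213P c av).
Qed.

Lemma word_faro (n : nat) (s t : 'S_n) :
  admissible 0 s -> admissible 1 t -> subexcedent_faro_words n (word s t).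
Proof.
move=> /admissibleP[ms bs] /admissibleP[mt bt]; split; last first.
  move=> x; rewrite tnth_mktuple /=.
  have := bs (mid_ord x); have := bt (mid_ord x); rewrite /=.
  case: ifP; lia.
case: n s t ms bs mt bt => [|n] s t ms bs mt bt.
  by exists [::], [::]; split=> //; rewrite (tuple0 (word s t)).
apply/(faroP ord0) => i hi.
have := nth_word s t ord0 (Ordinal (ltnW (ltnW hi))); rewrite /= => ->.
have := nth_word s t ord0 (Ordinal hi); rewrite /= => ->.
rewrite !addnS /= negbK.
by case: ifP => _; [apply: mt | apply: ms] => /=; lia.
Qed.

(** The entries of the codes of s and t that no letter of the word records are
    those that the bounds force to vanish. *)
Lemma word_inj (n : nat) (s t s' t' : 'S_n) :
  admissible 0 s -> admissible 1 t -> admissible 0 s' -> admissible 1 t' ->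
  word s t = word s' t' -> s = s' /\ t = t'.
Proof.
move=> /admissibleP[_ bs] /admissibleP[_ bt] /admissibleP[_ bs'] /admissibleP[_ bt'] e.
have get (c : bool) (r r' : 'S_n) :
    (forall j : 'I_n, inv_code r j <= j.*2 + c - n) ->
    (forall j : 'I_n, inv_code r' j <= j.*2 + c - n) ->
    (forall x : 'I_n, odd (n + x) = c ->
       inv_code r (mid_ord x) = inv_code r' (mid_ord x)) -> r = r'.
  move=> br br' er; apply: inv_code_inj => j.
  case: (leqP n (j.*2 + c)) => hj; last first.
    by have := br j; have := br' j; lia.
  have c1 : c <= 1 by case: (c).
  have hx : j.*2 + c - n < n by have := ltn_ord j; lia.
  have -> : j = mid_ord (Ordinal hx) by apply: val_inj => /=; lia.
  by apply: er => /=; case: (c) hj => /=; lia.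
have same x := nth_word s t x x; rewrite e in same.
split; [apply: (get false) | apply: (get true)] => // x hx.
  by have := same x; rewrite nth_word hx.
by have := same x; rewrite nth_word hx.
Qed.

(** The codes are read off the word, padded with zeros below the positions that
    the word records. *)
Lemma word_surj (n : nat) (w : n.-tuple 'I_n) :
  subexcedent_faro_words n w ->
  exists s t : 'S_n, [/\ admissible 0 s, admissible 1 t & word s t = w].
Proof.
case: n w => [|n] w [fw sw].
  exists 1%g, 1%g; split; [split; by case | split; by case | by rewrite tuple0 [RHS]tuple0].
have swn x : x < n.+1 -> nth ord0 w x <= x.
  by move=> hx; have := sw (Ordinal hx); rewrite (tnth_nth ord0).
have get (c : bool) : exists2 r : 'S_n.+1, admissible c r &
    forall x : 'I_n.+1, odd (n.+1 + x) = c -> inv_code r (mid_ord x) = nth ord0 w x.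
  pose f (j : 'I_n.+1) : nat :=
    if n < j.*2 + c then val (nth ord0 w (j.*2 + c - n.+1)) else 0.
  have hf (j : 'I_n.+1) : f j <= j.*2 + c - n.+1.
    rewrite /f; case: ifP => // h; apply: swn; have := ltn_ord j; case: (c) h; lia.
  have [|r er] := @inv_code_surj _ f.
    by move=> j; apply: leq_trans (hf j) _; have := ltn_ord j; case: (c); lia.
  exists r.
    apply/admissibleP; split=> [j k jk|j]; rewrite !er // /f.
    case: ifP => // hj; rewrite ifT; last lia.
    apply: faro_leq_nth => //; have := ltn_ord k; case: (c) hj; lia.
  move=> x hx; rewrite er /f /=; have lx := ltn_ord x.
  rewrite ifT; last by case: (c) hx; lia.
  by congr (val (nth _ _ _)); case: (c) hx; lia.
have [s as_ es] := get false; have [t at_ et] := get true.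
exists s, t; split=> //; apply: eq_from_tnth => x; apply: val_inj.
rewrite tnth_mktuple (tnth_nth ord0) /=.
by case: ifP => hx; [apply: et | apply: es].
Qed.

Theorem theorem4p7 (n : nat) (hn : 1 <= n) :
  exists f : n.-tuple 'I_n -> 'S_(2 * n),
    set_bij (subexcedent_faro_words n) (dumont2_avoiding_2143 n) f.
Proof.
have /choice[g gP] : forall w : n.-tuple 'I_n, exists st : 'S_n * 'S_n,
    subexcedent_faro_words n w ->
    [/\ admissible 0 st.1, admissible 1 st.2 & word st.1 st.2 = w].
  move=> w; have [/word_surj[s [t h]]|h] := pselect (subexcedent_faro_words n w).
    by exists (s, t).
  by exists (1%g, 1%g).
exists (fun w => merge (g w).1 (g w).2); split.
- by move=> w /gP[as_ at_ _]; apply/merge_dumont2_avoiding.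
- move=> w w'; rewrite !inE => /gP[_ _ ew] /gP[_ _ ew'] /merge_inj[e1 e2].
  by rewrite -ew -ew' e1 e2.
- move=> p dp; have [dum av] := dp.
  have [s [t ep]] := split_odd_low (dumont2_odd_low dum av).
  rewrite ep in dp; have [as_ at_] := (merge_dumont2_avoiding s t).1 dp.
  have fw := word_faro as_ at_; exists (word s t) => //=.
  have [as' at' ew] := gP _ fw.
  by have [-> ->] := word_inj as' at' as_ at_ ew.
Qed.
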